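(* Assume that $\mathbb F$ is algebraically closed with $\operatorname{char}\mathbb F=0$, and let $d$ be a nonnegative integer. Let $\mathbf M$ denote the set of all isomorphism classes of irreducible $\Re$-modules of dimension $d+1$. Then the map $\mathcal R\colon \mathbf P_d/\{\pm1\}^3\to\mathbf M$, $[a,b,c]\mapsto$ the isomorphism class of $R_d(a,b,c)$, is well defined and is a bijection.
   Context: The Racah algebra $\Re$ is the unital associative $\mathbb F$-algebra with generators $A,B,C,D$ and relations $[A,B]=[B,C]=[C,A]=2D$ together with the requirement that each of $\alpha:=[A,D]+AC-BA$, $\beta:=[B,D]+BA-CB$, $\gamma:=[C,D]+CB-AC$ is central in $\Re$; put $\delta:=A+B+C$ (also central). Here $[X,Y]=XY-YX$. For $a,b,c\in\mathbb F$ and $d\in\mathbb N$ set $\theta_i=(a+\tfrac d2-i)(a+\tfrac d2-i+1)$, $\theta_i^*=(b+\tfrac d2-i)(b+\tfrac d2-i+1)$ for $0\le i\le d$, and $\varphi_i=i(i-d-1)(a+b+c+\tfrac d2-i+2)(a+b-c+\tfrac d2-i+1)$ for $1\le i\le d$. $R_d(a,b,c)$ denotes the $(d+1)$-dimensional $\Re$-module with a basis $v_0,\dots,v_d$ such that $Av_i=\theta_iv_i+v_{i+1}$ (with $v_{d+1}=0$), $Bv_i=\theta_i^*v_i+\varphi_iv_{i-1}$ (with $v_{-1}=0$), and $\alpha,\beta,\delta$ act as the scalars $(c-b)(c+b+1)(a-\tfrac d2)(a+\tfrac d2+1)$, $(a-c)(a+c+1)(b-\tfrac d2)(b+\tfrac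 d2+1)$, $\tfrac d2(\tfrac d2+1)+a(a+1)+b(b+1)+c(c+1)$ respectively (such a module exists and is unique up to isomorphism). $\mathbf P_d$ is the set of $(a,b,c)\in\mathbb F^3$ such that none of $a+b+c+1$, $-a+b+c$, $a-b+c$, $a+b-c$ lies in $\{\tfrac d2-i\mid i=1,\dots,d\}$. The group $\{\pm1\}^3$ acts on $\mathbf P_d$ by $(a,b,c)^{(-1,1,1)}=(-a-1,b,c)$, $(a,b,c)^{(1,-1,1)}=(a,-b-1,c)$, $(a,b,c)^{(1,1,-1)}=(a,b,-c-1)$; $[a,b,c]$ denotes the orbit of $(a,b,c)$ and $\mathbf P_d/\{\pm1\}^3$ the set of orbits. *)

(* Defs.v *)
From HB Require Import structures.
From mathcomp Require Import all_boot all_order all_algebra.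
Set Implicit Arguments. Unset Strict Implicit. Unset Printing Implicit Defensive.
Import Order.TTheory GRing.Theory Num.Theory.
Local Open Scope ring_scope.

(* An n-dimensional module for the Racah algebra on F^n (column vectors):
   the images of the generators A, B, C, D as n x n matrices. *)
Record racah_mx (F : fieldType) (n : nat) := RacahMx {
  rA : 'M[F]_n; rB : 'M[F]_n; rC : 'M[F]_n; rD : 'M[F]_n }.

Section Racah.
Variable F : fieldType.
Variable n : nat.

Definition comm (X Y : 'M[F]_n) : 'M[F]_n := X *m Y - Y *m X.

Definition r_alpha (X : racah_mx F n) :=
  comm (rA X) (rD X) + rA X *m rC X - rB X *m rA X.
Definition r_beta (X : racah_mx F n) :=
  comm (rB X) (rD X) + rB X *m rA X - rC X *m rB X.
Definition r_gamma (X : racah_mx F n) :=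
  comm (rC X) (rD X) + rC X *m rB X - rA X *m rC X.
Definition r_delta (X : racah_mx F n) := rA X + rB X + rC X.

Definition commutes_all (X : racah_mx F n) (Z : 'M[F]_n) :=
  [/\ Z *m rA X = rA X *m Z, Z *m rB X = rB X *m Z,
      Z *m rC X = rC X *m Z & Z *m rD X = rD X *m Z].

Definition is_racah_module (X : racah_mx F n) : Prop :=
  [/\ comm (rA X) (rB X) = 2%:R *: rD X,
      comm (rB X) (rC X) = 2%:R *: rD X &
      comm (rC X) (rA X) = 2%:R *: rD X] /\
  [/\ commutes_all X (r_alpha X),
      commutes_all X (r_beta X) &
      commutes_all X (r_gamma X)].

(* Irreducible: nonzero and the only invariant subspaces are 0 and F^n.
   A subspace is represented by a matrix U whose ROWS span its transpose,
   i.e. the column-space of U^T; invariance under X is stablemx U X^T. *)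
Definition racah_irreducible (X : racah_mx F n) : Prop :=
  (0 < n)%N /\
  forall U : 'M[F]_n,
    stablemx U (rA X)^T -> stablemx U (rB X)^T ->
    stablemx U (rC X)^T -> stablemx U (rD X)^T ->
    (U == (0 : 'M[F]_n))%MS || row_full U.

Definition racah_iso (X Y : racah_mx F n) : Prop :=
  exists P : 'M[F]_n, P \in unitmx /\
    [/\ P *m rA X = rA Y *m P, P *m rB X = rB Y *m P,
        P *m rC X = rC Y *m P & P *m rD X = rD Y *m P].
End Racah.

Section Rd.
Variable F : fieldType.
Variable d : nat.
Let h : F := d%:R / 2%:R.

Definition thetaR (a : F) (i : nat) : F := (a + h - i%:R) * (a + h - i%:R + 1).
Definition phiR (a b c : F) (i : nat) : F :=
  i%:R * (i%:R - d%:R - 1) * (a + b + c + h - i%:R + 2%:R) * (a + b - c + h - i%:R + 1).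

Definition alpha_sc (a b c : F) : F := (c - b) * (c + b + 1) * (a - h) * (a + h + 1).
Definition beta_sc (a b c : F) : F := (a - c) * (a + c + 1) * (b - h) * (b + h + 1).
Definition delta_sc (a b c : F) : F :=
  h * (h + 1) + a * (a + 1) + b * (b + 1) + c * (c + 1).

(* Matrix entry (j,i) = coefficient of v_j in X v_i. *)
Definition Rd_A (a : F) : 'M[F]_d.+1 :=
  \matrix_(j, i) (if j == i then thetaR a i
                  else if (j == i.+1 :> nat) then 1 else 0).
Definition Rd_B (a b c : F) : 'M[F]_d.+1 :=
  \matrix_(j, i) (if j == i then thetaR b i
                  else if (j.+1 == i :> nat) then phiR a b c i else 0).

(* C and D are forced: C = delta - A - B and D = [A,B]/2. *)
Definition Rd (a b c : F) : racah_mx F d.+1 :=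
  RacahMx (Rd_A a) (Rd_B a b c)
    ((delta_sc a b c)%:M - Rd_A a - Rd_B a b c)
    ((2%:R)^-1 *: comm (Rd_A a) (Rd_B a b c)).

Definition bad (x : F) : Prop := exists2 i : nat, (1 <= i <= d)%N & x = h - i%:R.
Definition inPd (a b c : F) : Prop :=
  [/\ ~ bad (a + b + c + 1), ~ bad (- a + b + c), ~ bad (a - b + c) & ~ bad (a + b - c)].
End Rd.

Definition flip (F : fieldType) (s : bool) (x : F) : F := if s then - x - 1 else x.
Definition same_orbit (F : fieldType) (a b c a' b' c' : F) : Prop :=
  exists s1 s2 s3 : bool, [/\ a' = flip s1 a, b' = flip s2 b & c' = flip s3 c].

(* Main.v *)
(* All matrices are transposed, so that vectors are rows and invariant subspaces
   are row spaces; the defining relations are invariant under transposition, and,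
   up to (alpha, beta) -> (-beta, -alpha), under exchanging A and B.

   For a fixed scalar delta a module is a pair (A, B) with
   A^2 B - 2 A B A + B A^2 = 2 (A B + B A) + 2 A^2 - 2 delta A + 2 alpha and its
   mirror image. If w_i A = theta_i w_i + w_(i+1) for all i, the first relation
   determines w_(i+2) B from w_i B and w_(i+1) B, so the shape
   w_i B = theta*_i w_i + phi_i w_(i-1) propagates from i = 0, 1. Applied in
   R_d(a,b,c) to the string obtained from v_0 by taking the theta_i in reverse
   order, this yields an intertwiner from R_d(-a-1,b,c); applied to the string of
   v_d under B it exchanges A and B. The map c -> -c-1 does not change phi.

   Irreducibility: B moves any nonzero vector to one with a nonzero coordinate on
   v_0, the product of the A - theta_i (i > 0) sends that vector to a multiple of
   the last vector of the reversed string, and B moves this down to v_0, because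
   neither phi_i nor its analogue for -a-1 vanishes.

   Injectivity follows from the traces of A, B and C. For surjectivity choose x
   with x(x+1) an eigenvalue of A and (x+1)(x+2) not, and y likewise for B. A
   B-eigenvector generates a string w on which B is triangular, and an eigenvector
   of the transpose of A gives a dual string; together they make B bidiagonal on w.
   The phi_i then have prescribed second differences and vanish at 0 and d + 1,
   which determines them. *)

Require Import Defs.
From HB Require Import structures.
From mathcomp Require Import all_boot all_order all_algebra.
From mathcomp Require Import ring zify.
Import GRing.Theory.
Local Open Scope ring_scope.
Set Implicit Arguments. Unset Strict Implicit. Unset Printing Implicit Defensive.

(** * The defining relation in A and B alone, and its recursion along strings *)

Section Relation.
Variable F : fieldType.

(** Linear-combination device: an equation follows from a known one as soon as [ring] or [field]
    identifies the differences of their sides. *)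
Lemma eq_of_sub (x y u v : F) : u = v -> x - y = u - v -> x = y.
Proof. by move=> -> /eqP; rewrite subrr subr_eq0 => /eqP. Qed.

(** This is twice the equation [r_alpha] = [al] after the substitutions C = [dl] - A - B and D =
    [A, B] / 2. With A and B exchanged it expresses [r_beta] = - [al]. *)
Definition racah_rel n (A B : 'M[F]_n) (dl al : F) : Prop :=
  A *m A *m B - 2%:R *: (A *m B *m A) + B *m A *m A =
  2%:R *: (A *m B + B *m A) + 2%:R *: (A *m A) - (2%:R * dl) *: A + (2%:R * al)%:M.

Lemma racah_rel_tr n (A B : 'M[F]_n) dl al :
  racah_rel A B dl al -> racah_rel A^T B^T dl al.
Proof.
rewrite /racah_rel -!trmx_mul !mulmxA.
move: (A *m A *m B) (A *m B *m A) (B *m A *m A) (A *m B) (B *m A) (A *m A) => M1 M2 M3 M4 M5 M6.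
move=> E; rewrite -(tr_scalar_mx n (2%:R * al)).
apply/matrixP => i j; have := congr1 (fun M : 'M_n => M j i) E.
by rewrite !mxE => E'; apply: (eq_of_sub E'); ring.
Qed.

Lemma racah_rel_row n (A B : 'M[F]_n) dl al (v : 'rV_n) :
  racah_rel A B dl al ->
  v *m A *m A *m B - 2%:R *: (v *m A *m B *m A) + v *m B *m A *m A =
  2%:R *: (v *m A *m B + v *m B *m A) + 2%:R *: (v *m A *m A)
    - (2%:R * dl) *: (v *m A) + (2%:R * al) *: v.
Proof.
move/(congr1 (mulmx v)); rewrite !(mulmxDr, mulmxN, mulmxA, scalemxAr).
by rewrite -!scalemxAr mul_mx_scalar !(mulmxDr, mulmxA).
Qed.

Lemma row_racah_rel n (A B : 'M[F]_n) dl al :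
  (forall i, let v := delta_mx 0 i : 'rV_n in
  v *m A *m A *m B - 2%:R *: (v *m A *m B *m A) + v *m B *m A *m A =
  2%:R *: (v *m A *m B + v *m B *m A) + 2%:R *: (v *m A *m A)
    - (2%:R * dl) *: (v *m A) + (2%:R * al) *: v) -> racah_rel A B dl al.
Proof.
move=> H; apply/row_matrixP => i; rewrite !rowE.
rewrite !(mulmxDr, mulmxN, mulmxA).
rewrite -!scalemxAr mul_mx_scalar !(mulmxDr, mulmxA).
exact: H.
Qed.

(** These are the numbers [thetaR d a k] with y = a + d/2, freed from d. Their second difference in
    k is 2. *)
Definition tau (y : F) (k : nat) : F := (y - k%:R) * (y - k%:R + 1).

(** In the relation applied to w_i, the only term not given by the hypotheses is w_(i+2) B, so the
    relation can be solved for it. At i = 0 the truncated predecessor [i.-1] is harmless because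
    [p 0] = 0. *)
Lemma rel_recursion n (A B : 'M[F]_n) dl al (t s p : nat -> F) (w : nat -> 'rV_n) i :
  racah_rel A B dl al ->
  (forall k, (k <= i.+1)%N -> w k *m A = t k *: w k + w k.+1) ->
  (forall k, (k <= i.+1)%N -> w k *m B = s k *: w k + p k *: w k.-1) -> p 0 = 0 ->
  w i.+2 *m B = (2%:R * s i.+1 - s i + 2%:R) *: w i.+2 +
     (2%:R * p i.+1 - p i + 2%:R * (s i * t i + s i.+1 * t i.+1) - (t i + t i.+1) * (s i + s i.+1)
       + 2%:R * (s i + s i.+1) + 2%:R * (t i + t i.+1) - 2%:R * dl) *: w i.+1
    + (p i.+1 * (t i + 2%:R - t i.+1) - p i * (t i.-1 - t i - 2%:R)
       + 4%:R * t i * s i + 2%:R * t i * t i - 2%:R * dl * t i + 2%:R * al) *: w i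
    + (p i * (2%:R * (t i + t i.-1) - (t i - t i.-1) ^+ 2)) *: w i.-1.
Proof.
move=> rel wA wB p0.
have := racah_rel_row (w i) rel.
have wA0 := wA i (leqnSn i); have wB0 := wB i (leqnSn i).
have wA1 := wA i.+1 (leqnn _); have wB1 := wB i.+1 (leqnn _).
have wA2 : p i *: w i.-1 *m A = (p i * t i.-1) *: w i.-1 + p i *: w i.
  case: (i) wA wB => [|k] wA wB; first by rewrite p0 !scale0r mul0r scale0r mul0mx addr0.
  by rewrite -scalemxAl wA ?scalerDr ?scalerA //; apply: leqW; apply: leqW.
have wA3 : (p i * t i.-1) *: w i.-1 *m A = (p i * t i.-1 * t i.-1) *: w i.-1 + (p i * t i.-1) *: w i.
  case: (i) wA wB => [|k] wA wB; first by rewrite p0 !(mul0r, scale0r) mul0mx addr0.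
  by rewrite -scalemxAl wA ?scalerDr ?scalerA //; apply: leqW; apply: leqW.
do 7! rewrite ?(wA0, wA1, wB0, wB1, wA2, wA3, mulmxDl) /= -?scalemxAl.
set Z := w i.+2 *m B; set Y := w i.+2; set x3 := w i.-1.
move=> E; apply/rowP => j; have {E} := congr1 (fun u : 'rV_n => u 0 j) E; rewrite !mxE => E.
by apply: (eq_of_sub E); ring.
Qed.
End Relation.

(** * The model R_d in terms of row vectors *)

Section Rows.
Variables (F : fieldType) (d : nat).
(** Indexing by all natural numbers, with value 0 beyond d, lets the formulas for A and B hold
    without boundary cases. *)
Definition unit_row (i : nat) : 'rV[F]_d.+1 := \row_j (j == i :> nat)%:R.

Lemma unit_row_delta (i : 'I_d.+1) : unit_row i = delta_mx 0 i.
Proof. by apply/rowP => j; rewrite !mxE eqxx. Qed.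

Lemma unit_row_big i : (d < i)%N -> unit_row i = 0.
Proof.
move=> lti; apply/rowP => j; rewrite !mxE; case: eqP => // E.
by have := ltn_ord j; rewrite E ltnS leqNgt lti.
Qed.

Definition RA (a : F) : 'M[F]_d.+1 := (Rd_A d a)^T.
Definition RB (a b c : F) : 'M[F]_d.+1 := (Rd_B d a b c)^T.

Lemma unit_row_RA a i : unit_row i *m RA a = thetaR d a i *: unit_row i + unit_row i.+1.
Proof.
case: (ltnP i d.+1) => [lti|gti]; last first.
  by rewrite !unit_row_big ?(leqW gti) // mul0mx scaler0 addr0.
apply/rowP => j; rewrite -{1}[i]/(val (Ordinal lti)) unit_row_delta -rowE !mxE.
rewrite -val_eqE /=; case: (ltngtP j i) => [ji|ji|->].
- by rewrite (ltn_eqF (leqW ji)) mulr0 addr0.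
- by rewrite mulr0 add0r; case: eqP.
by rewrite mulr1 ltn_eqF // addr0.
Qed.

Lemma unit_row_RB a b c i :
  unit_row i *m RB a b c = thetaR d b i *: unit_row i + phiR d a b c i *: unit_row i.-1.
Proof.
case: (ltnP i d.+1) => [lti|gti]; last first.
  rewrite unit_row_big // mul0mx scaler0 add0r.
  case: (ltngtP d.+1 i) gti => // [lti|<-] _.
    by rewrite unit_row_big ?scaler0 //; case: i lti.
  (* For i = d + 1 the right-hand side involves v_d, but the factor i - d - 1 of phi_i vanishes. *)
  have E : d.+1%:R - d%:R - 1 = 0 :> F by ring.
  by rewrite /phiR E mulr0 !mul0r scale0r.
apply/rowP => j; rewrite -{1}[i]/(val (Ordinal lti)) unit_row_delta -rowE !mxE.
rewrite -val_eqE /=; case: (ltngtP j i) => [ji|ji|->].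
- rewrite mulr0 add0r; case: i lti ji => //= i lti ji.
  by rewrite eqSS; case: eqP; rewrite ?mulr1 ?mulr0.
- rewrite mulr0 add0r; case: eqP => [E|_]; first by lia.
  by case: eqP => [E|_]; [lia|rewrite mulr0].
rewrite mulr1; case: i lti => [|i] lti /=.
  by rewrite /phiR !mul0r addr0.
by rewrite gtn_eqF // mulr0 addr0.
Qed.

Lemma row_ext (M N : 'M[F]_d.+1) :
  (forall i, unit_row i *m M = unit_row i *m N) -> M = N.
Proof.
by move=> H; apply/row_matrixP => i; rewrite !rowE -unit_row_delta.
Qed.

Hypothesis nz2 : (2%:R : F) != 0.

(** With these values of [thetaR] and [phiR], the coefficients of w_i and w_(i-1) in [rel_recursion]
    vanish, so the two initial formulas propagate. *)
Lemma string_B (A B : 'M[F]_d.+1) (a b c : F) (w : nat -> 'rV_d.+1) :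
  racah_rel A B (delta_sc d a b c) (alpha_sc d a b c) ->
  (forall i, w i *m A = thetaR d a i *: w i + w i.+1) ->
  w 0 *m B = thetaR d b 0 *: w 0 ->
  w 1 *m B = thetaR d b 1 *: w 1 + phiR d a b c 1 *: w 0 ->
  forall i, w i *m B = thetaR d b i *: w i + phiR d a b c i *: w i.-1.
Proof.
move=> rel wA wB0 wB1 i; elim/ltn_ind: i => -[_|[_|i IH]].
- by rewrite wB0 /phiR !mul0r scale0r addr0.
- by [].
have p0 : phiR d a b c 0 = 0 by rewrite /phiR !mul0r.
rewrite (rel_recursion rel (fun k _ => wA k) (fun k lek => IH k lek) p0).
apply/rowP => j; case: i {IH} => [|i]; rewrite /= !mxE /thetaR /phiR /delta_sc /alpha_sc;
  by field.
Qed.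

Lemma Rd_rel_alpha a b c : racah_rel (RA a) (RB a b c) (delta_sc d a b c) (alpha_sc d a b c).
Proof.
apply: row_racah_rel => k /=; rewrite -unit_row_delta; move: (nat_of_ord k) => {k} i.
do 7! rewrite ?(unit_row_RA, unit_row_RB, mulmxDl) /= -?scalemxAl.
case: i => [|i] /=.
  apply/rowP=> j.
  move: (unit_row 0) (unit_row 1) (unit_row 2) => u0 u1 u2.
  rewrite !mxE /thetaR /phiR /delta_sc /alpha_sc /=; field; exact: nz2.
apply/rowP=> j.
move: (unit_row i) (unit_row i.-1) (unit_row i.+1) (unit_row i.+2) (unit_row i.+3) => u0 um u1 u2 u3.
rewrite !mxE /thetaR /phiR /delta_sc /alpha_sc /=; field; exact: nz2.
Qed.

Lemma Rd_rel_beta a b c : racah_rel (RB a b c) (RA a) (delta_sc d a b c) (- beta_sc d a b c).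
Proof.
apply: row_racah_rel => k /=; rewrite -unit_row_delta; move: (nat_of_ord k) => {k} i.
do 7! rewrite ?(unit_row_RA, unit_row_RB, mulmxDl) /= -?scalemxAl.
(* B is applied up to twice here and lowers the index each time, so i = 0 and i = 1 both meet the
   truncated predecessor. *)
case: i => [|[|i]] /=.
- apply/rowP=> j.
  move: (unit_row 0) (unit_row 1) (unit_row 2) => u0 u1 u2.
  rewrite !mxE /thetaR /phiR /delta_sc /beta_sc /=; field; exact: nz2.
- apply/rowP=> j.
  move: (unit_row 0) (unit_row 1) (unit_row 2) (unit_row 3) => u0 u1 u2 u3.
  rewrite !mxE /thetaR /phiR /delta_sc /beta_sc /=; field; exact: nz2.
apply/rowP=> j.
move: (unit_row i) (unit_row i.-1) (unit_row i.+1) (unit_row i.+2) (unit_row i.+3) => u0 um u1 u2 u3.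
rewrite !mxE /thetaR /phiR /delta_sc /beta_sc /=; field; exact: nz2.
Qed.
End Rows.

(** * Irreducible pairs of matrices, intertwiners and strings *)

Section Pairs.
Variable F : fieldType.

Definition pair_irr n (A B : 'M[F]_n) : Prop :=
  forall U : 'M[F]_n, stablemx U A -> stablemx U B -> U != 0 -> row_full U.

Definition pair_iso n (A B A' B' : 'M[F]_n) : Prop :=
  exists2 P : 'M[F]_n, P \in unitmx & P *m A = A' *m P /\ P *m B = B' *m P.

Lemma pair_iso_sym n (A B A' B' : 'M[F]_n) : pair_iso A B A' B' -> pair_iso A' B' A B.
Proof.
case=> P uP [PA PB]; exists (invmx P); first by rewrite unitmx_inv.
split; apply: (can_inj (mulKmx uP)); apply: (can_inj (mulmxK uP));
  by rewrite !mulmxA mulmxV // mul1mx -?PA -?PB -!mulmxA mulVmx // mulmx1.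
Qed.

Lemma pair_iso_trans n (A B A' B' A'' B'' : 'M[F]_n) :
  pair_iso A B A' B' -> pair_iso A' B' A'' B'' -> pair_iso A B A'' B''.
Proof.
case=> P uP [PA PB] [Q uQ [QA QB]]; exists (Q *m P); first by rewrite unitmx_mul uQ.
by split; rewrite -mulmxA ?PA ?PB mulmxA ?QA ?QB mulmxA.
Qed.

Lemma pair_iso_swap n (A B A' B' : 'M[F]_n) : pair_iso A B A' B' -> pair_iso B A B' A'.
Proof. by case=> P uP [PA PB]; exists P. Qed.

Lemma pair_irr_swap n (A B : 'M[F]_n) : pair_irr A B -> pair_irr B A.
Proof. by move=> irr U UB UA; apply: irr. Qed.

Lemma pair_irr_iso n (A B A' B' : 'M[F]_n) :
  pair_iso A B A' B' -> pair_irr A B -> pair_irr A' B'.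
Proof.
case=> P uP [PA PB] irr U UA UB U0.
have st X X' : P *m X = X' *m P -> stablemx U X' -> stablemx (U *m P) X.
  by move=> PX UX; rewrite -mulmxA PX mulmxA submxMr.
have : row_full (U *m P).
  apply: irr; [exact: st PA UA | exact: st PB UB|].
  by apply: contraNneq U0 => UP0; rewrite -[U](mulmxK uP) UP0 mul0mx.
by rewrite /row_full mxrankMfree ?row_free_unit.
Qed.

(** The annihilator [kermx U^T] of a subspace stable under the transposes is stable under A and B;
    it is nonzero if U is proper, and it is full only if U is 0. *)
Lemma pair_irr_tr n (A B : 'M[F]_n) : pair_irr A B -> pair_irr A^T B^T.
Proof.
move=> irr U UA UB U0; rewrite -[row_full U]negbK; apply: contra U0 => nfull.
have st X : stablemx U X^T -> stablemx (kermx U^T) X.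
  case/submxP=> M UM; apply/sub_kermxP.
  rewrite -mulmxA -[X]trmxK -trmx_mul UM trmx_mul mulmxA.
  by rewrite mulmx_ker mul0mx.
have : row_full (kermx U^T).
  apply: irr; [exact: st|exact: st|].
  by rewrite kermx_eq0 -[row_free _]/(\rank _ == n) mxrank_tr.
rewrite /row_full mxrank_ker mxrank_tr -mxrank_eq0 => /eqP; move: (rank_leq_col U).
by move=> ? ?; apply/eqP; lia.
Qed.

(** The row space of the intertwiner [P] is stable under A and B, so irreducibility of this one pair
    makes [P] invertible. *)
Lemma schur_iso n (A B A' B' P : 'M[F]_n) : pair_irr A B ->
  P *m A = A' *m P -> P *m B = B' *m P -> P != 0 -> pair_iso A B A' B'.
Proof.
move=> irr PA PB P0; exists P => //; rewrite -row_full_unit.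
by apply: irr P0; rewrite ?PA ?PB submxMl.
Qed.

Fixpoint lstring n (A : 'M[F]_n) (t : nat -> F) (v : 'rV[F]_n) (i : nat) : 'rV[F]_n :=
  if i is k.+1 then lstring A t v k *m A - t k *: lstring A t v k else v.

Lemma lstringE n (A : 'M[F]_n) t v i :
  lstring A t v i *m A = t i *: lstring A t v i + lstring A t v i.+1.
Proof. by rewrite /= addrC subrK. Qed.

Lemma lstring_horner n (A : 'M[F]_n.+1) t v i :
  lstring A t v i = v *m horner_mx A (\prod_(j < i) ('X - (t j)%:P)).
Proof.
elim: i => [|i IH]; first by rewrite big_ord0 rmorph1 mulmx1.
rewrite big_ord_recr /= rmorphM /= mulmxA -IH rmorphB /= horner_mx_X horner_mx_C.
by rewrite mulmxBr mul_mx_scalar.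
Qed.

(** By Cayley-Hamilton, a string that runs through all roots of the characteristic polynomial ends
    in 0, whatever the order of the roots. *)
Lemma lstring_char n (A : 'M[F]_n.+1) (t : nat -> F) v :
  char_poly A = \prod_(j < n.+1) ('X - (t j)%:P) -> lstring A t v n.+1 = 0.
Proof. by move=> cA; rewrite lstring_horner -cA Cayley_Hamilton mulmx0. Qed.

End Pairs.

(** * Symmetries and irreducibility of the model *)

Section Model.
Variables (F : fieldType) (d : nat).
Hypothesis ch : [pchar F] =i pred0.

Lemma natr_neq0 n : (n.+1%:R : F) != 0.
Proof. by rewrite ((pcharf0P F).1 ch). Qed.
Let nz2 : (2%:R : F) != 0 := natr_neq0 1.

Lemma unit_row_mul_matrix (w : nat -> 'rV[F]_d.+1) i : (i < d.+1)%N ->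
  unit_row F d i *m \matrix_(k < d.+1) w k = w i.
Proof.
by move=> lti; rewrite -[i in LHS]/(val (Ordinal lti)) unit_row_delta -rowE rowK.
Qed.

(** The matrix with rows w_0, ..., w_d is an intertwiner; being nonzero, it is invertible by
    [schur_iso], so linear independence of the string comes for free. *)
Lemma string_iso (A B : 'M[F]_d.+1) (a b c : F) (w : nat -> 'rV_d.+1) :
  pair_irr A B -> w 0 != 0 -> w d.+1 = 0 ->
  (forall i, (i <= d)%N -> w i *m A = thetaR d a i *: w i + w i.+1) ->
  (forall i, (i <= d)%N -> w i *m B = thetaR d b i *: w i + phiR d a b c i *: w i.-1) ->
  pair_iso A B (RA d a) (RB d a b c).
Proof.
move=> irr w0 wd wA wB; set P : 'M_d.+1 := \matrix_(k < d.+1) w k.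
have Pw i : (i <= d.+1)%N -> unit_row F d i *m P = w i.
  rewrite leq_eqVlt => /orP[/eqP->|lti]; first by rewrite unit_row_big // mul0mx wd.
  exact: unit_row_mul_matrix.
apply: (schur_iso irr (P := P)).
- apply/row_matrixP => i; rewrite !rowE -unit_row_delta !mulmxA.
  have lei : (i <= d)%N by rewrite -ltnS.
  by rewrite unit_row_RA mulmxDl -scalemxAl !Pw // ?wA // leqW.
- apply/row_matrixP => i; rewrite !rowE -unit_row_delta !mulmxA.
  have lei : (i <= d)%N by rewrite -ltnS.
  rewrite unit_row_RB mulmxDl -!scalemxAl !Pw ?wB // ?leqW //.
  by apply: leq_trans (leq_pred _) _.
by apply: contraNneq w0 => P0; rewrite -Pw // P0 mulmx0.
Qed.

(** The function x(x + 1) is invariant under x -> -x - 1, which sends -a - 1 + d/2 - i to a + d/2 -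
    (d - i). *)
Lemma thetaR_flip (a : F) i : (i <= d)%N -> thetaR d (- a - 1) i = thetaR d a (d - i).
Proof.
move=> lei; rewrite /thetaR natrB //.
have E : (d%:R : F) = d%:R / 2%:R + d%:R / 2%:R by field.
rewrite [in X in _ = (_ - X) * _]E [in X in _ = _ * (_ - X + _)]E; ring.
Qed.

Lemma delta_flip_a (a b c : F) : delta_sc d (- a - 1) b c = delta_sc d a b c.
Proof. by rewrite /delta_sc; ring. Qed.

Lemma alpha_flip_a (a b c : F) : alpha_sc d (- a - 1) b c = alpha_sc d a b c.
Proof. by rewrite /alpha_sc; ring. Qed.

Lemma char_poly_tr n (A : 'M[F]_n) : char_poly A^T = char_poly A.
Proof.
rewrite /char_poly -det_tr; congr (\det _).
by apply/matrixP => i j; rewrite !mxE eq_sym.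
Qed.

Lemma char_RA (a : F) : char_poly (RA d a) = \prod_(j < d.+1) ('X - (thetaR d a j)%:P).
Proof.
rewrite char_poly_tr char_poly_trig.
  by apply: eq_bigr => i _; rewrite mxE eqxx.
apply/is_trig_mxP => i j ltij; rewrite mxE -val_eqE /= ltn_eqF //.
by rewrite ltn_eqF // leqW.
Qed.

Lemma char_RB (a b c : F) : char_poly (RB d a b c) = \prod_(j < d.+1) ('X - (thetaR d b j)%:P).
Proof.
rewrite char_poly_trig.
  by apply: eq_bigr => i _; rewrite !mxE eqxx.
apply/is_trig_mxP => i j ltij; rewrite !mxE -val_eqE /= gtn_eqF //.
by rewrite gtn_eqF // leqW.
Qed.

Lemma prod_flip (a : F) : \prod_(j < d.+1) ('X - (thetaR d (- a - 1) j)%:P) =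
   \prod_(j < d.+1) ('X - (thetaR d a j)%:P).
Proof.
rewrite (reindex_inj rev_ord_inj) /=; apply: eq_bigr => i _.
by rewrite subSS thetaR_flip ?leq_subr // subKn // -ltnS.
Qed.

Definition flip_string (a : F) := lstring (RA d a) (thetaR d (- a - 1)) (unit_row F d 0).

Lemma flip_string_last a : flip_string a d.+1 = 0.
Proof. by apply: lstring_char; rewrite char_RA prod_flip. Qed.

(** The parameters a and -a - 1 share alpha and delta, so [string_B] applies with -a - 1; the
    formulas for w_0 and w_1 are checked by hand. *)
Lemma flip_string_B a b c i : flip_string a i *m RB d a b c =
  thetaR d b i *: flip_string a i + phiR d (- a - 1) b c i *: flip_string a i.-1.
Proof.
apply: (string_B nz2 (A := RA d a) (w := flip_string a)).
- rewrite delta_flip_a alpha_flip_a; exact: Rd_rel_alpha.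
- exact: lstringE.
- by rewrite /= unit_row_RB /phiR !mul0r scale0r addr0.
rewrite /flip_string /= mulmxBl -scalemxAl unit_row_RA mulmxDl -scalemxAl !unit_row_RB /=.
apply/rowP => j; rewrite !mxE /thetaR /phiR; field; exact: nz2.
Qed.

Lemma flip_iso (a b c : F) : pair_irr (RA d a) (RB d a b c) ->
  pair_iso (RA d a) (RB d a b c) (RA d (- a - 1)) (RB d (- a - 1) b c).
Proof.
move=> irr; apply: (string_iso irr (w := flip_string a)).
- apply/negP=> /eqP /rowP /(_ ord0); rewrite !mxE eqxx => /eqP.
  by rewrite oner_eq0.
- exact: flip_string_last.
- by move=> i _; apply: lstringE.
by move=> i _; apply: flip_string_B.
Qed.

Lemma Rd_pair_irr (a b c : F) :
  (forall i, (1 <= i <= d)%N -> phiR d a b c i != 0) ->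
  (forall i, (1 <= i <= d)%N -> phiR d (- a - 1) b c i != 0) ->
  pair_irr (RA d a) (RB d a b c).
Proof.
move=> phi0 phi0' U UA UB U0.
have stA (w : 'rV_d.+1) : (w <= U)%MS -> (w *m RA d a <= U)%MS.
  by move=> wU; apply: submx_trans (submxMr _ wU) UA.
have stB (w : 'rV_d.+1) : (w <= U)%MS -> (w *m RB d a b c <= U)%MS.
  by move=> wU; apply: submx_trans (submxMr _ wU) UB.
have [w wU w0] : exists2 w : 'rV_d.+1, (w <= U)%MS & w 0 0 != 0.
  (* Induction on the position m of the first nonzero coordinate: B moves it to m - 1, multiplied by
     phi_m. *)
  have main m : (m <= d)%N -> forall w : 'rV_d.+1, (w <= U)%MS -> w 0 (inord m) != 0 ->
      (forall j : 'I_d.+1, (j < m)%N -> w 0 j = 0) -> exists2 w : 'rV_d.+1, (w <= U)%MS & w 0 0 != 0.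
    elim: m => [|m IH] lem w wU wm wj.
      by exists w => //; rewrite -(inord_val (0 : 'I_d.+1)).
    apply: (IH (ltnW lem) (w *m RB d a b c)); first exact: stB.
      rewrite mxE (bigD1 (inord m.+1)) //= !mxE !inordK // ?(ltnW lem) //; last by rewrite ltnS ltnW.
      rewrite -val_eqE /= !inordK //; last by rewrite ltnS ltnW.
      rewrite ltn_eqF // eqxx big1 ?addr0.
        by apply: mulf_neq0 => //; apply: phi0.
      move=> k; rewrite -val_eqE /= !mxE -val_eqE /= !inordK //; last by rewrite ltnS ltnW.
      move=> km; case: eqP => [km'|_]; first by rewrite wj ?mul0r // -km'.
      by rewrite eq_sym (negPf km) mulr0.
    move=> j ltj; rewrite mxE big1 // => k _; rewrite !mxE -val_eqE /=.
    case: (ltnP k m.+1) => [ltk|lek]; first by rewrite wj ?mul0r.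
    by rewrite !ltn_eqF ?mulr0 //; lia.
  case/rowV0Pn: U0 => w wU w0.
  case/rV0Pn: w0 => k0 wk0.
  have ex : exists m, (m <= d)%N && (w 0 (inord m) != 0).
    by exists k0; rewrite inord_val wk0 -ltnS ltn_ord.
  case: (ex_minnP ex) => m /andP[lem wm] mmin.
  apply: (main m lem w wU wm) => j ltj; apply/eqP/negPn/negP => wj0.
  have : (m <= j)%N by apply: mmin; rewrite -ltnS ltn_ord inord_val.
  by rewrite leqNgt ltj.
(* The reversed sequence stops before its last term theta_0, so q is the product of the X - theta_i
   with i > 0. *)
pose q := \prod_(j < d) ('X - (thetaR d (- a - 1) j)%:P).
(* Since v_1 = v_0 (A - theta_0), v_1 q(A) is the end of the flipped string, hence 0; later v_i
   follow because A - theta_i commutes with q(A). *)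
have qE i : unit_row F d i.+1 *m horner_mx (RA d a) q = 0.
  have comm p : GRing.comm (RA d a - p%:M) (horner_mx (RA d a) q).
    have -> : RA d a - p%:M = horner_mx (RA d a) ('X - p%:P).
      by rewrite rmorphB /= horner_mx_X horner_mx_C.
    exact: comm_horner_mx2.
  have step p : unit_row F d p.+1 *m horner_mx (RA d a) q =
      unit_row F d p *m horner_mx (RA d a) q *m (RA d a - (thetaR d a p)%:M).
    rewrite -mulmxA -[horner_mx _ _ *m _]/(horner_mx _ _ * _) -comm mulmxA.
    by rewrite mulmxBr unit_row_RA mul_mx_scalar addrC addKr.
  elim: i => [|i IH]; last by rewrite step IH mul0mx.
  rewrite step -lstring_horner mulmxBr mul_mx_scalar.
  rewrite -[RHS](flip_string_last a) /flip_string /=.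
  by rewrite thetaR_flip // subnn.
have wq : w *m horner_mx (RA d a) q = w 0 0 *: flip_string a d.
  rewrite [in LHS](row_sum_delta w) mulmx_suml (bigD1 ord0) //= big1 ?addr0.
    by rewrite -scalemxAl -unit_row_delta -lstring_horner.
  move=> i i0; rewrite -scalemxAl -unit_row_delta.
  have -> : val i = (val i).-1.+1 by rewrite prednK // lt0n.
  by rewrite qE scaler0.
have fU i : (i <= d)%N -> (flip_string a (d - i) <= U)%MS.
  elim: i => [|i IH] lti.
    rewrite subn0 -(eqmx_scale _ w0) -wq.
    apply: submx_trans (submxMr _ wU) _; exact: horner_mx_stable.
  have := stB _ (IH (ltnW lti)); rewrite flip_string_B -subnS => inU.
  have p0 : phiR d (- a - 1) b c (d - i) != 0 by apply: phi0'; lia.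
  rewrite -(eqmx_scale _ p0) -[X in (X <= _)%MS](addKr (thetaR d b (d - i) *: flip_string a (d - i))).
  by rewrite addmx_sub // -scaleNr scalemx_sub // IH // ltnW.
(* The flipped string starts at v_0, and A raises v_0 to all the other basis vectors. *)
have eU i : (unit_row F d i <= U)%MS.
  elim: i => [|i IH]; first by have := fU d (leqnn d); rewrite subnn.
  rewrite -[X in (X <= _)%MS](addKr (thetaR d a i *: unit_row F d i)) -unit_row_RA.
  by rewrite addmx_sub ?stA // -scaleNr scalemx_sub.
rewrite -sub1mx; apply/row_subP => i; rewrite rowE mulmx1 -unit_row_delta; exact: eU.
Qed.

Lemma inPd_phi (a b c : F) i : inPd d a b c -> (1 <= i <= d)%N -> phiR d a b c i != 0.
Proof.
case=> p1 _ _ p4 /andP[i1 id].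
have E : (d%:R : F) = d%:R / 2%:R + d%:R / 2%:R by field.
have bad_i (x : F) : x + d%:R / 2%:R - i%:R + 1 = 0 -> bad d x.
  (* The equation reads x = i - 1 - d/2 = d/2 - (d + 1 - i). *)
  move=> x0; exists (d.+1 - i)%N; first by lia.
  apply: (eq_of_sub x0); rewrite natrB; last by lia.
  rewrite -[d.+1%:R]natr1 [in X in _ - (_ - (X + _ - _))]E; ring.
rewrite /phiR !mulf_neq0 //.
- by case: i i1 {id bad_i} => // i _; apply: natr_neq0.
- have -> : i%:R - d%:R - 1 = - (d - i).+1%:R :> F by rewrite -natr1 natrB //; ring.
  by rewrite oppr_eq0 natr_neq0.
- apply/eqP => H; apply: p1; apply: bad_i; rewrite -[RHS]H; ring.
by apply/eqP => H; apply: p4; apply: bad_i.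
Qed.

Lemma bad_opp (x : F) : bad d x -> bad d (- x - 1).
Proof.
have E : (d%:R : F) = d%:R / 2%:R + d%:R / 2%:R by field.
case=> i /andP[i1 id] ->; exists (d.+1 - i)%N; first by lia.
rewrite natrB; last by lia.
by rewrite -[d.+1%:R]natr1 [in X in _ = _ - (X + _ - _)]E; ring.
Qed.

(** The linear factors of phi_i exclude bad values of a + b + c + 1 and a + b - c. Those for -a - 1
    do the same for -a + b + c and -a - 1 + b - c, and [bad_opp] turns the latter into a - b + c. *)
Lemma phi_inPd (a b c : F) :
  (forall i, (1 <= i <= d)%N -> phiR d a b c i != 0) ->
  (forall i, (1 <= i <= d)%N -> phiR d (- a - 1) b c i != 0) -> inPd d a b c.
Proof.
move=> phi0 phi0'.
have E : (d%:R : F) = d%:R / 2%:R + d%:R / 2%:R by field.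
have L1 a' (x : F) : (forall i, (1 <= i <= d)%N -> phiR d a' b c i != 0) ->
  (x = a' + b + c + 1) \/ (x = a' + b - c) -> ~ bad d x.
  move=> phi Hx [i /andP[i1 id] xE].
  have r1 : (1 <= d.+1 - i <= d)%N by lia.
  move: (phi _ r1); rewrite /phiR.
  have F0 : x + d%:R / 2%:R - (d.+1 - i)%:R + 1 = 0.
    rewrite xE natrB; last by lia.
    by rewrite -[d.+1%:R]natr1 [in X in _ - (X + _ - _)]E; ring.
  case: Hx => Hx.
    have -> : a' + b + c + d%:R / 2%:R - (d.+1 - i)%:R + 2%:R = 0 by rewrite -[RHS]F0 Hx; ring.
    by rewrite mulr0 mul0r eqxx.
  have -> : a' + b - c + d%:R / 2%:R - (d.+1 - i)%:R + 1 = 0 by rewrite -[RHS]F0 Hx; ring.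
  by rewrite mulr0 eqxx.
split.
- by apply: (L1 a) => //; left.
- by apply: (L1 (- a - 1)) => //; left; ring.
- by move/bad_opp; apply: (L1 (- a - 1)) => //; right; ring.
by apply: (L1 a) => //; right.
Qed.

Lemma inPd_flip_a (a b c : F) : inPd d a b c -> inPd d (- a - 1) b c.
Proof.
case=> p1 p2 p3 p4; split.
- by have -> : - a - 1 + b + c + 1 = - a + b + c by ring.
- by have -> : - (- a - 1) + b + c = a + b + c + 1 by ring.
- move/bad_opp; have -> : - (- a - 1 - b + c) - 1 = a + b - c by ring.
  by [].
move/bad_opp; have -> : - (- a - 1 + b - c) - 1 = a - b + c by ring.
by [].
Qed.

Lemma inPd_flip_b (a b c : F) : inPd d a b c -> inPd d a (- b - 1) c.
Proof.
case=> p1 p2 p3 p4; split.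
- by have -> : a + (- b - 1) + c + 1 = a - b + c by ring.
- move/bad_opp; have -> : - (- a + (- b - 1) + c) - 1 = a + b - c by ring.
  by [].
- by have -> : a - (- b - 1) + c = a + b + c + 1 by ring.
move/bad_opp; have -> : - (a + (- b - 1) - c) - 1 = - a + b + c by ring.
by [].
Qed.

Lemma inPd_irr (a b c : F) : inPd d a b c -> pair_irr (RA d a) (RB d a b c).
Proof.
move=> abc; apply: Rd_pair_irr => i ri; apply: inPd_phi => //.
exact: inPd_flip_a.
Qed.

(* v_d is annihilated by A - theta_d and lowered by B: reversing the basis
   exchanges the roles of A and B. *)
Lemma swap_iso (a b c : F) : pair_irr (RA d a) (RB d a b c) ->
  pair_iso (RB d a b c) (RA d a) (RA d (- b - 1)) (RB d (- b - 1) (- a - 1) c).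
Proof.
move=> irr.
pose w := lstring (RB d a b c) (thetaR d (- b - 1)) (unit_row F d d).
have wA i : w i *m RB d a b c = thetaR d (- b - 1) i *: w i + w i.+1 by apply: lstringE.
apply: (string_iso (pair_irr_swap irr) (w := w)).
- apply/negP=> /eqP /rowP /(_ ord_max); rewrite !mxE eqxx => /eqP.
  by rewrite oner_eq0.
- by apply: lstring_char; rewrite char_RB prod_flip.
- by move=> i _.
move=> i _; apply: (string_B nz2 (A := RB d a b c) (w := w)) => //.
- have -> : delta_sc d (- b - 1) (- a - 1) c = delta_sc d a b c by rewrite /delta_sc; ring.
  have -> : alpha_sc d (- b - 1) (- a - 1) c = - beta_sc d a b c.
    by rewrite /alpha_sc /beta_sc; ring.
  exact: Rd_rel_beta.
- by rewrite /w /= unit_row_RA [unit_row _ _ d.+1]unit_row_big // addr0 thetaR_flip ?subn0.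
rewrite /w /= mulmxBl -scalemxAl unit_row_RB mulmxDl -!scalemxAl !unit_row_RA.
rewrite [unit_row _ _ d.+1]unit_row_big // addr0.
case: (posnP d) => [d0|dp].
  have d0F : (d%:R : F) = 0 by rewrite d0.
  apply/rowP => j; rewrite !mxE /thetaR /phiR d0F; field; exact: nz2.
have dF : (d.-1%:R : F) = d%:R - 1 by rewrite -[d in RHS]prednK // -natr1 addrK.
rewrite prednK //; apply/rowP => j; rewrite !mxE /thetaR /phiR dF; field; exact: nz2.
Qed.

End Model.

(** * Flags spanned by strings, and triangularity with respect to them *)

Section Krylov.
Variables (F : fieldType) (n : nat).
Implicit Types (A B : 'M[F]_n) (w : nat -> 'rV[F]_n).

Definition span_lt w k : 'M[F]_n := (\sum_(j < k) <<w j>>)%MS.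

Lemma span_lt_mem w j k : (j < k)%N -> (w j <= span_lt w k)%MS.
Proof.
move=> ltj; apply: submx_trans (sumsmx_sup (Ordinal ltj) isT (submx_refl _)).
by rewrite genmxE.
Qed.

Lemma span_lt_sub w k m (U : 'M_(m, n)) :
  (forall j, (j < k)%N -> (w j <= U)%MS) -> (span_lt w k <= U)%MS.
Proof. by move=> H; apply/sumsmx_subP => j _; rewrite genmxE H. Qed.

Lemma span_lt_leq w j k : (j <= k)%N -> (span_lt w j <= span_lt w k)%MS.
Proof. by move=> lejk; apply: span_lt_sub => i lti; apply/span_lt_mem/(leq_trans lti). Qed.

Lemma span_ltS w k : span_lt w k.+1 = (span_lt w k + <<w k>>)%MS.
Proof. by rewrite /span_lt big_ord_recr. Qed.

Lemma rank_span_lt w k : (\rank (span_lt w k) <= k)%N.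
Proof.
elim: k => [|k IH]; first by rewrite /span_lt big_ord0 mxrank0.
rewrite span_ltS; apply: leq_trans (mxrank_adds_leqif _ _) _.
rewrite -(addn1 k) leq_add // genmxE; exact: rank_leq_row.
Qed.

Lemma span_lt_rank w k :
  (forall m, (m < k)%N -> ~~ (w m <= span_lt w m)%MS) -> \rank (span_lt w k) = k.
Proof.
move=> ind; apply/eqP; rewrite eqn_leq rank_span_lt /=.
elim: k ind => [|k IH] ind //.
have IHk : (k <= \rank (span_lt w k))%N by apply: IH => m ltm; apply: ind; apply: leqW.
apply: leq_ltn_trans IHk _; apply: rank_ltmx; rewrite ltmxE span_lt_leq //=.
apply: contra (ind k (leqnn _)) => H; apply: submx_trans H; exact: span_lt_mem.
Qed.

Lemma span_lt_mulr A t w k (u : 'rV_n) : (forall i, w i *m A = t i *: w i + w i.+1) ->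
  (u <= span_lt w k)%MS -> (u *m A <= span_lt w k.+1)%MS.
Proof.
move=> wA; elim: k u => [|k IH] u.
  by rewrite {1}/span_lt big_ord0 submx0 => /eqP->; rewrite mul0mx sub0mx.
rewrite span_ltS => /sub_addsmxP [[a b] /= ->]; rewrite mulmxDl addmx_sub //.
  by apply: submx_trans (span_lt_leq w (leqnSn _)); apply: IH; apply: submxMl.
have /sub_rVP [c ->] : (b *m <<w k>> <= w k)%MS by rewrite (submx_trans (submxMl _ _)) ?genmxE.
rewrite -scalemxAl scalemx_sub // wA addmx_sub ?span_lt_mem // scalemx_sub //.
exact: span_lt_mem.
Qed.

(* (B - tau y 1) (B - (y+1)(y+2)) sends v A into the line of v, and the second
   factor is invertible. *)
Lemma eigenvector_step A B dl be y (v : 'rV_n) :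
  racah_rel B A dl be -> v *m B = tau y 0 *: v -> ~~ eigenvalue B ((y + 1) * (y + 2%:R)) ->
  v != 0 -> exists k, v *m A *m B = tau y 1 *: (v *m A) + k *: v.
Proof.
move=> rel vB nev v0; set tn := (y + 1) * (y + 2%:R) in nev *.
have tn0 : tau y 0 - tn != 0.
  apply: contra nev; rewrite subr_eq0 => /eqP E.
  by apply/eigenvalueP; exists v; rewrite // -E.
set T0 := tau y 0 in vB tn0 *; pose c := 2%:R * T0 ^+ 2 - 2%:R * dl * T0 + 2%:R * be.
pose k := c / (T0 - tn); exists k.
(* The vector v A (B - tau y 1)(B - [tn]) equals c v, and B - [tn] acts on v as [T0] - [tn]; hence
   this k makes u (B - [tn]) vanish, and u = 0 since [tn] is not an eigenvalue. *)
pose u := v *m A *m B - tau y 1 *: (v *m A) - k *: v.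
have uB : u *m B = tn *: u.
  have := racah_rel_row v rel.
  rewrite /u !mulmxBl -!scalemxAl !vB -!scalemxAl !vB -!scalemxAl.
  set X := v *m A *m B; set Z := X *m B; set Y := v *m A => E.
  have kE : c = k * (T0 - tn) by rewrite divfK.
  apply/rowP => j; have {}E := congr1 (fun M : 'rV_n => M 0 j) E.
  have {kE} := f_equal2 +%R E (congr1 ( *%R (v 0 j)) kE).
  clearbody Z X Y k; rewrite !mxE /c /T0 /tn /tau => {}E.
  apply: (eq_of_sub E); ring.
apply/eqP; rewrite -subr_eq0 opprD addrA; apply: contraNT nev => u0.
by apply/eigenvalueP; exists u.
Qed.

(** The relation at w_k expresses w_(k+2) B through w_k B and w_(k+1) B. The diagonal entries match
    because [tau] has second difference 2. The shifts [t] stay arbitrary, so that the lemma also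
    covers the dual string. *)
Lemma krylov_triangular A B dl al y t k0 w :
  racah_rel A B dl al -> (forall i, w i *m A = t i *: w i + w i.+1) ->
  w 0%N *m B = tau y 0 *: w 0%N ->
  w 0%N *m A *m B = tau y 1 *: (w 0%N *m A) + k0 *: w 0%N -> forall k,
  (w k *m B - tau y k *: w k <= span_lt w k)%MS.
Proof.
move=> rel wA vB vAB; elim/ltn_ind => -[_|[_|k IH]].
- by rewrite vB subrr sub0mx.
- have -> : w 1 *m B - tau y 1 *: w 1 = (k0 + t 0%N * (tau y 1 - tau y 0)) *: w 0%N.
    have -> : w 1 = w 0%N *m A - t 0%N *: w 0%N by rewrite wA addrC addKr.
    rewrite mulmxBl -scalemxAl vB vAB; move: (w 0%N *m A) => u.
    by apply/rowP => j; rewrite !mxE; ring.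
  by rewrite scalemx_sub // span_lt_mem.
have := racah_rel_row (w k) rel.
have := IH k.+1 (leqnn _); have := IH k (leqW (leqnn _)).
set r := (X in (X <= _)%MS -> _); set r' := (X in _ -> (X <= _)%MS -> _) => rS rS'.
have wB : w k *m B = tau y k *: w k + r by rewrite addrC subrK.
have wB' : w k.+1 *m B = tau y k.+1 *: w k.+1 + r' by rewrite addrC subrK.
have rA := span_lt_mulr wA rS; have rA' := span_lt_mulr wA rS'.
have rAA := span_lt_mulr wA rA.
clearbody r r'.
do 7! rewrite ?(wA, wB, wB', mulmxDl) /= -?scalemxAl.
move=> E.
(* The relation solved for the new error term; each application of A to the old errors r and r'
   climbs one step of the flag, so every summand stays below level k + 2. *)
have -> : w k.+2 *m B - tau y k.+2 *: w k.+2 =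
  (4%:R * t k * tau y k + 2%:R * t k * t k - 2%:R * dl * t k + 2%:R * al) *: w k
  + (2%:R * (t k * tau y k + tau y k.+1 * t k.+1) - (tau y k + tau y k.+1) * (t k + t k.+1)
       + 2%:R * (tau y k + tau y k.+1) + 2%:R * (t k + t k.+1) - 2%:R * dl) *: w k.+1
  + (2%:R * t k - t k ^+ 2) *: r + (2%:R - t k - t k.+1) *: r'
  + (2%:R * t k + 2%:R) *: (r *m A) + 2%:R *: (r' *m A) - r *m A *m A.
  move: (w k.+2 *m B) (w k.+2) (r *m A *m A) (r *m A) (r' *m A) E => Z z x1 x2 x3 E.
  apply/rowP => j; have {E} := congr1 (fun M : 'rV_n => M 0 j) E.
  move: (w k) (w k.+1) => x y1; rewrite !mxE /tau => E; apply: (eq_of_sub E); ring.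
have S1 := span_lt_leq w (leqnSn k.+1); have S2 := span_lt_leq w (leqW (leqnSn k)).
rewrite ?(addmx_sub, scalemx_sub, eqmx_opp) //.
- exact: span_lt_mem (leqW (leqnn _)).
- exact: span_lt_mem.
- exact: submx_trans rS S2.
- exact: submx_trans rS' S1.
exact: submx_trans rA S1.
Qed.

Lemma span_lt_stable A w m :
  (forall j, (j < m)%N -> (w j *m A <= span_lt w m)%MS) -> stablemx (span_lt w m) A.
Proof.
move=> H; apply/row_subP => i; rewrite row_mul.
have : (row i (span_lt w m) <= span_lt w m)%MS by apply: row_sub.
move: (row _ _) => u; rewrite {1}/span_lt => /sub_sumsmxP [f ->].
rewrite mulmx_suml summx_sub // => j _.
have /sub_rVP [c ->] : (f j *m <<w j>> <= w j)%MS by rewrite (submx_trans (submxMl _ _)) ?genmxE.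
by rewrite -scalemxAl scalemx_sub // H.
Qed.

(** If w_m lay in the span of its predecessors, that span would be stable under A and B and nonzero,
    yet of dimension at most m < n. *)
Lemma krylov_free A B t y w :
  pair_irr A B -> w 0%N != 0 -> (forall i, w i *m A = t i *: w i + w i.+1) ->
  (forall k, (w k *m B - tau y k *: w k <= span_lt w k)%MS) ->
  forall m, (m < n)%N -> ~~ (w m <= span_lt w m)%MS.
Proof.
move=> irr w0 wA wB m ltm; apply/negP => wm.
have m0 : (0 < m)%N.
  by case: m wm {ltm} => //; rewrite /span_lt big_ord0 submx0 (negPf w0).
have : row_full (span_lt w m).
  apply: irr.
  - apply: span_lt_stable => j ltj; rewrite wA addmx_sub //; first by rewrite scalemx_sub // span_lt_mem.
    move: ltj; rewrite leq_eqVlt => /orP[/eqP jm|]; last exact: span_lt_mem.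
    by rewrite jm.
  - apply: span_lt_stable => j ltj; rewrite -[_ *m B](subrK (tau y j *: w j)) addmx_sub //.
      exact: submx_trans (wB j) (span_lt_leq w (ltnW ltj)).
    by rewrite scalemx_sub // span_lt_mem.
  apply: contraNneq w0 => S0; rewrite -submx0 -S0; exact: span_lt_mem.
rewrite /row_full => /eqP full; have := rank_span_lt w m; rewrite full; lia.
Qed.

Lemma free_unitmx w : (forall m, (m < n)%N -> ~~ (w m <= span_lt w m)%MS) ->
  \matrix_(k < n) w k \in unitmx.
Proof.
move=> ind; rewrite -row_full_unit -sub1mx; apply: (submx_trans (B := span_lt w n)).
  by rewrite submx_full // /row_full span_lt_rank.
apply: span_lt_sub => j ltj.
by have := row_sub (Ordinal ltj) (\matrix_(k < n) w k); rewrite rowK.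
Qed.

(** For k <= i, moving A across the pairing gives (l_k, w_(i+1)) = (th_k - th_i)(l_k, w_i), as lower
    l_j already annihilate w_i. This is 0 if k = i, and by induction on i otherwise. *)
Lemma dual_string_orth A th (w l : nat -> 'rV[F]_n) :
  (forall i, w i *m A = th i *: w i + w i.+1) ->
  (forall k, (l k *m A^T - th k *: l k <= span_lt l k)%MS) ->
  forall k i, (k < i)%N -> l k *m (w i)^T = 0.
Proof.
move=> wA lA; elim/ltn_ind => k IHk; elim=> // i IHi; rewrite ltnS => leki.
have -> : w i.+1 = w i *m A - th i *: w i by rewrite wA addrC addKr.
have r0 : (l k *m A^T - th k *: l k) *m (w i)^T = 0.
  apply/eqP; rewrite -sub_kermx; apply: submx_trans (lA k) _.
  apply: span_lt_sub => j ltj; rewrite sub_kermx IHk //.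
  exact: leq_trans ltj leki.
have E : l k *m A^T *m (w i)^T = th k *: (l k *m (w i)^T).
  by apply/eqP; rewrite -subr_eq0 scalemxAl -mulmxBl r0.
rewrite linearB /= linearZ /= trmx_mul mulmxBr mulmxA E -scalemxAr.
case: (ltngtP k i) leki => // [lt _|-> _]; last by rewrite subrr.
by rewrite IHi // !scaler0 subrr.
Qed.

End Krylov.

(** * Bidiagonal form of an irreducible pair *)

Section Bidiagonal.
Variables (F : fieldType) (d : nat).
Implicit Types (A B : 'M[F]_d.+1).

(* B is triangular on the string w spanned under A by a B-eigenvector; pairing w
   with the analogous string of the transposed pair shows that B w_i has no
   component on w_j for j < i - 1. *)
Lemma bidiagonal_string A B dl al be x y :
  racah_rel A B dl al -> racah_rel B A dl be -> pair_irr A B ->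
  eigenvalue A (tau x 0) -> ~~ eigenvalue A ((x + 1) * (x + 2%:R)) ->
  eigenvalue B (tau y 0) -> ~~ eigenvalue B ((y + 1) * (y + 2%:R)) ->
  exists w : nat -> 'rV[F]_d.+1, exists p : nat -> F,
  [/\ w d.+1 = 0, p 0%N = 0, p d.+1 = 0 &
   [/\ forall i, w i *m A = tau x i *: w i + w i.+1,
     forall i, w i *m B = tau y i *: w i + p i *: w i.-1 &
     forall m, (m <= d)%N -> ~~ (w m <= span_lt w m)%MS]].
Proof.
move=> relA relB irr eA neA /eigenvalueP[v vB v0] neB.
have [l lA l0] : exists2 l : 'rV_d.+1, l *m A^T = tau x 0 *: l & l != 0.
  by apply/eigenvalueP; rewrite eigenvalue_root_char char_poly_tr -eigenvalue_root_char.
have neA' : ~~ eigenvalue A^T ((x + 1) * (x + 2%:R)).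
  by rewrite eigenvalue_root_char char_poly_tr -eigenvalue_root_char.
have [k vAB] := eigenvector_step relB vB neB v0.
have [k' lBA] := eigenvector_step (racah_rel_tr relA) lA neA' l0.
(* The dual string has zero shifts, so that l_k B^T is exactly l_(k+1). *)
pose w := lstring A (tau x) v; pose ls := lstring B^T (fun=> 0) l.
have wA i : w i *m A = tau x i *: w i + w i.+1 by apply: lstringE.
have lB i : ls i *m B^T = 0 *: ls i + ls i.+1 by apply: lstringE.
have wB i : (w i *m B - tau y i *: w i <= span_lt w i)%MS.
  exact: krylov_triangular relA wA vB vAB i.
have lsA i : (ls i *m A^T - tau x i *: ls i <= span_lt ls i)%MS.
  exact: krylov_triangular (racah_rel_tr relB) lB lA lBA i.
have wfree := krylov_free irr v0 wA wB.
have lfree := krylov_free (pair_irr_swap (pair_irr_tr irr)) l0 lB lsA.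
have orth := dual_string_orth wA lsA.
have lfull (u : 'rV_d.+1) : (forall j, (j < d.+1)%N -> ls j *m u^T = 0) -> u = 0.
  move=> H; apply: trmx_inj; rewrite trmx0 -[u^T]mul1mx; apply/eqP.
  rewrite -sub_kermx; apply: (submx_trans (B := span_lt ls d.+1)).
    by apply: submx_full; rewrite /row_full span_lt_rank.
  by apply: span_lt_sub => j ltj; rewrite sub_kermx H.
have wd : w d.+1 = 0 by apply: lfull => j ltj; apply: orth.
(* The Gram matrix of the two strings is invertible and, by [orth], triangular; so its diagonal
   entries are nonzero. *)
have diag j : (j < d.+1)%N -> ls j *m (w j)^T != 0.
  move=> ltj; pose L := \matrix_(k < d.+1) ls k; pose W := \matrix_(k < d.+1) w k.
  have GE i m : (L *m W^T) i m = (ls i *m (w m)^T) 0 0.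
    by rewrite !mxE; apply: eq_bigr => q _; rewrite !mxE.
  have : L *m W^T \in unitmx by rewrite unitmx_mul unitmx_tr !free_unitmx.
  rewrite unitmxE det_trig; last first.
    by apply/is_trig_mxP => i m ltim; rewrite GE orth // mxE.
  rewrite unitfE prodf_seq_neq0 => /allP /(_ (Ordinal ltj)).
  rewrite mem_index_enum GE => /(_ isT); apply: contraNneq => ->.
  by rewrite mxE.
have wbig i : (d < i)%N -> w i = 0.
  elim: i => // i IH; rewrite ltnS leq_eqVlt => /orP[/eqP<-//|lti].
  by have := wA i; rewrite IH // mul0mx scaler0 add0r.
have rB i : (w i.+1 *m B - tau y i.+1 *: w i.+1 <= w i)%MS.
  case: (ltnP i d) => [ltid|leid]; last by rewrite wbig // mul0mx scaler0 subrr sub0mx.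
  set r := _ - _.
  have rorth k0 : (k0 < i)%N -> ls k0 *m r^T = 0.
    move=> ltk; rewrite linearB /= linearZ /= trmx_mul mulmxBr mulmxA lB -scalemxAr.
    by rewrite scale0r add0r !orth ?scaler0 ?subrr // ltnW.
  (* The components on w_0, w_1, ... are removed one at a time: l_m annihilates r and all later w_j
     but not w_m. *)
  have main m : (m <= i)%N -> (r <= \sum_(m <= j < i.+1) <<w j>>)%MS.
    elim: m => [_|m IH ltm]; first by rewrite big_mkord; apply: wB.
    have := IH (ltnW ltm); rewrite big_ltn; last exact: leqW.
    set U := (\sum_(_ <= j < _) _)%MS => /sub_addsmxP [[a b] /= rE].
    have [c cE] : exists c, a *m <<w m>>%MS = c *: w m.
      by apply/sub_rVP; rewrite (submx_trans (submxMl _ _)) ?genmxE.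
    have bU : ls m *m (b *m U)^T = 0.
      apply: trmx_inj; rewrite trmx_mul trmxK trmx0; apply/eqP; rewrite -sub_kermx.
      apply: submx_trans (submxMl _ _) _; rewrite /U big_seq_cond.
      rewrite big_mkcond /=.
      elim/big_ind: _ => [|X Y XK YK|j _]; rewrite ?sub0mx ?addsmx_sub ?XK //.
      case: ifP => [|_]; rewrite ?sub0mx // mem_index_iota andbT => /andP[ltmj _].
      rewrite genmxE sub_kermx; apply/eqP/trmx_inj.
      by rewrite trmx_mul trmxK trmx0 orth.
    have := rorth m ltm; rewrite rE cE linearD /= linearZ /= mulmxDr bU addr0 -scalemxAr.
    move/eqP; rewrite scaler_eq0 (negPf (diag _ _)) ?orbF; last by apply: leq_trans ltm _; apply: ltnW; apply: ltnW.
    by move/eqP->; rewrite scale0r add0r submxMl.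
  have := main i (leqnn _); by rewrite big_nat1 genmxE.
pose r i := w i *m B - tau y i *: w i.
(* By [rB] each [r i.+1] is a multiple of [w i], and [pinvmx] reads off the factor. As [r d.+1] is
   0, this choice gives [p d.+1] = 0. *)
pose p i := if i is k.+1 then (r i *m pinvmx (w k)) 0 0 else 0.
exists w, p; split=> //.
  by rewrite /p /r wd mul0mx scaler0 subrr mul0mx mxE.
split=> // -[|i].
  have := wB 0%N; rewrite /span_lt big_ord0 submx0 subr_eq0 => /eqP->.
  by rewrite scale0r addr0.
rewrite -[p i.+1 *: _]mul_scalar_mx /p /= -mx11_scalar mulmxKpV; last exact: rB.
by rewrite addrC subrK.
Qed.

End Bidiagonal.

(** * Passage between Racah modules and pairs of matrices *)

Section Bridge.
Variables (F : fieldType) (n : nat).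
Hypothesis nz2 : (2%:R : F) != 0.
Implicit Types X Y : racah_mx F n.

Lemma eq_half_comm X : comm (rA X) (rB X) = 2%:R *: rD X ->
  rD X = 2%:R^-1 *: (rA X *m rB X - rB X *m rA X).
Proof. by rewrite -[_ - _]/(comm _ _) => ->; rewrite scalerA mulVf // scale1r. Qed.

Lemma r_alphaP X dl al : comm (rA X) (rB X) = 2%:R *: rD X ->
  rC X = dl%:M - rA X - rB X ->
  (r_alpha X = al%:M <-> racah_rel (rA X) (rB X) dl al).
Proof.
move=> /eq_half_comm; case: X => A B C D /= -> ->.
rewrite /r_alpha /comm /racah_rel /=.
rewrite !(mulmxBr, mulmxBl, =^~ scalemxAl, =^~ scalemxAr, mulmxA, mul_mx_scalar).
move: (A *m A *m B) (A *m B *m A) (B *m A *m A) (A *m B) (B *m A) (A *m A) => M1 M2 M3 M4 M5 M6.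
split=> E; apply/matrixP => i j; have {E} := congr1 (fun M : 'M_n => M i j) E; rewrite !mxE => E.
  apply: (eq_of_sub (congr1 ( *%R 2%:R) E)); field; exact: nz2.
apply: (eq_of_sub (congr1 ( *%R 2%:R^-1) E)); field; exact: nz2.
Qed.

Lemma r_betaP X dl be : comm (rA X) (rB X) = 2%:R *: rD X ->
  rC X = dl%:M - rA X - rB X ->
  (r_beta X = be%:M <-> racah_rel (rB X) (rA X) dl (- be)).
Proof.
move=> /eq_half_comm; case: X => A B C D /= -> ->.
rewrite /r_beta /comm /racah_rel /=.
rewrite !(mulmxBr, mulmxBl, =^~ scalemxAl, =^~ scalemxAr, mulmxA, mul_scalar_mx).
move: (B *m B *m A) (B *m A *m B) (A *m B *m B) (A *m B) (B *m A) (B *m B) => M1 M2 M3 M4 M5 M6.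
split=> E; apply/matrixP => i j; have {E} := congr1 (fun M : 'M_n => M i j) E; rewrite !mxE => E.
  apply: (eq_of_sub (congr1 ( *%R (- 2%:R)) E)); field; exact: nz2.
apply: (eq_of_sub (congr1 ( *%R (- 2%:R^-1)) E)); field; exact: nz2.
Qed.

Lemma commutes_all_scalar X c : commutes_all X c%:M.
Proof. by split; rewrite scalar_mxC. Qed.

(** The sum alpha + beta + gamma is [delta, D], which is 0 for scalar delta; hence gamma is a scalar
    too. *)
Lemma racah_module_of_rel X dl al be : comm (rA X) (rB X) = 2%:R *: rD X ->
  rC X = dl%:M - rA X - rB X -> r_alpha X = al%:M -> r_beta X = be%:M -> is_racah_module X.
Proof.
move=> D2 CE alE beE.
have gaE : r_gamma X = (- al - be)%:M.
  have : r_alpha X + r_beta X + r_gamma X = 0.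
    rewrite /r_alpha /r_beta /r_gamma /comm CE.
    rewrite !(mulmxBr, mulmxBl, mul_scalar_mx, mul_mx_scalar).
    move: (rA X *m rD X) (rD X *m rA X) (rB X *m rD X) (rD X *m rB X).
    move: (rA X *m rA X) (rA X *m rB X) (rB X *m rA X) (rB X *m rB X) => *.
    by apply/matrixP => i j; rewrite !mxE; ring.
  rewrite alE beE => E; apply/matrixP => i j.
  have {}E := congr1 (fun M : 'M_n => M i j) E; move: E; rewrite !mxE => E.
  by apply: (eq_of_sub E); ring.
split; last by rewrite alE beE gaE; split; apply: commutes_all_scalar.
split=> //; rewrite -D2 /comm CE !(mulmxBr, mulmxBl, mul_scalar_mx, mul_mx_scalar);
  move: (rA X *m rA X) (rA X *m rB X) (rB X *m rA X) (rB X *m rB X) => *;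
  by apply/matrixP => i j; rewrite !mxE; ring.
Qed.

(** Transposition reverses the direction of an intertwiner, whence the exchanged order of [X] and
    [Y] in the last hypothesis. *)
Lemma racah_iso_pair X Y dl :
  comm (rA X) (rB X) = 2%:R *: rD X -> comm (rA Y) (rB Y) = 2%:R *: rD Y ->
  rC X = dl%:M - rA X - rB X -> rC Y = dl%:M - rA Y - rB Y ->
  pair_iso (rA Y)^T (rB Y)^T (rA X)^T (rB X)^T -> racah_iso X Y.
Proof.
move=> /eq_half_comm DX /eq_half_comm DY CX CY [Q uQ [QA QB]].
have {}QA : Q^T *m rA X = rA Y *m Q^T by apply: trmx_inj; rewrite !trmx_mul trmxK QA.
have {}QB : Q^T *m rB X = rB Y *m Q^T by apply: trmx_inj; rewrite !trmx_mul trmxK QB.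
exists Q^T; split; first by rewrite unitmx_tr.
split=> //.
  by rewrite CX CY !mulmxBr !mulmxBl QA QB scalar_mxC.
rewrite DX DY -scalemxAr -scalemxAl mulmxBr mulmxBl; congr (_ *: (_ - _)).
  by rewrite mulmxA QA -mulmxA QB mulmxA.
by rewrite mulmxA QB -mulmxA QA mulmxA.
Qed.

Lemma irr_of_pair X : (0 < n)%N -> pair_irr (rA X)^T (rB X)^T -> racah_irreducible X.
Proof.
move=> n0 irr; split=> // U UA UB _ _; rewrite submx0 sub0mx andbT.
by case: eqVneq => //= U0; apply: irr.
Qed.

Lemma pair_of_irr X dl :
  comm (rA X) (rB X) = 2%:R *: rD X -> rC X = dl%:M - rA X - rB X ->
  racah_irreducible X -> pair_irr (rA X)^T (rB X)^T.
Proof.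
move=> /eq_half_comm DX CX [_ irr] U UA UB U0.
have UC : stablemx U (rC X)^T.
  have -> : (rC X)^T = dl%:M - (rA X)^T - (rB X)^T.
    by rewrite CX; apply/matrixP => i j; rewrite !mxE eq_sym.
  by rewrite !stablemxD ?stablemxN ?stablemxC.
have UD : stablemx U (rD X)^T.
  have -> : (rD X)^T = (2%:R^-1)%:M *m ((rB X)^T *m (rA X)^T - (rA X)^T *m (rB X)^T).
    rewrite DX mul_scalar_mx -!trmx_mul; move: (rA X *m rB X) (rB X *m rA X) => M N.
    by apply/matrixP => i j; rewrite !mxE.
  by rewrite stablemxM ?stablemxC // stablemxD ?stablemxN ?stablemxM.
by have := irr U UA UB UC UD; rewrite submx0 sub0mx andbT (negPf U0).
Qed.

End Bridge.

(** * Eigenvalues and Schur's lemma over an algebraically closed field *)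

Section Closed.
Variable F : closedFieldType.

Lemma solve_quadratic (a : F) : exists x, x * (x + 1) = a.
Proof.
have [x xE] := @solve_monicpoly F 2 (fun i => if i == 0 then a else -1) isT.
exists x; move: xE; rewrite !big_ord_recl big_ord0 /= => E; apply: (eq_of_sub E); ring.
Qed.

Lemma exists_eigenvalue n (A : 'M[F]_n) : (0 < n)%N -> exists a, eigenvalue A a.
Proof.
move=> n0; have /closed_rootP [a ra] : size (char_poly A) != 1%N.
  by rewrite size_char_poly eqSS -lt0n.
by exists a; rewrite eigenvalue_root_char.
Qed.

Lemma racah_schur n (X : racah_mx F n) (Z : 'M_n) :
  racah_irreducible X -> commutes_all X Z -> exists c, Z = c%:M.
Proof.
case=> n0 irr [ZA ZB ZC ZD]; have [c eZ] := exists_eigenvalue Z^T n0; exists c.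
have st Y : Z *m Y = Y *m Z -> stablemx (eigenspace Z^T c) Y^T.
  by move=> E; apply: comm_mx_stable_eigenspace; rewrite /comm_mx -!trmx_mul E.
have := irr _ (st _ ZA) (st _ ZB) (st _ ZC) (st _ ZD).
rewrite submx0 sub0mx andbT; move: eZ; rewrite /eigenvalue => /negPf -> /=.
rewrite -sub1mx => /eigenspaceP; rewrite mul1mx scalemx1 => E.
by apply: trmx_inj; rewrite E tr_scalar_mx.
Qed.

Hypothesis ch : [pchar F] =i pred0.

(** Starting from an eigenvalue x0 (x0 + 1), the shifts x0 + k cannot all give eigenvalues in
    characteristic 0; x is the shift just before the first failure. *)
Lemma exists_last_eigenvalue n (A : 'M[F]_n) : (0 < n)%N ->
  exists x, eigenvalue A (tau x 0) /\ ~~ eigenvalue A ((x + 1) * (x + 2%:R)).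
Proof.
move=> n0; have [a ea] := exists_eigenvalue A n0; have [x0 x0E] := solve_quadratic a.
pose T k : F := (x0 + k%:R) * (x0 + k%:R + 1).
have [k ek] : exists k, ~~ eigenvalue A (T k).
  (* Distinct shifts may give equal values x(x + 1); composing with X(X + 1) allows counting the
     shifts themselves as roots. *)
  pose q : {poly F} := char_poly A \Po ('X * ('X + 1)).
  have q0 : q != 0.
    rewrite comp_poly_eq0 ?monic_neq0 ?char_poly_monic //.
    by rewrite mulrDr mulr1 -expr2 size_polyDl size_polyXn // size_polyX.
  have inj : injective (fun k : nat => x0 + k%:R).
    move=> i j /addrI /eqP; case: (leqP i j) => [le|/ltnW le]; last rewrite eq_sym;
      rewrite -subr_eq0 -opprB oppr_eq0 -natrB // ((pcharf0P F).1 ch) subn_eq0 => le';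
      apply/eqP; rewrite eqn_leq ?le ?le' //.
  pose s := [seq x0 + k%:R | k <- iota 0 (size q)].
  have us : uniq s by rewrite map_inj_uniq ?iota_uniq.
  have := contra (fun h => max_poly_roots q0 h us); rewrite size_map size_iota ltnn => /(_ isT).
  case/allPn => _ /mapP [k _ ->] rk; exists k; move: rk.
  by rewrite /root horner_comp !hornerE eigenvalue_root_char.
have ex : exists k, ~~ eigenvalue A (T k) by exists k.
case: (ex_minnP ex) => -[|m] em mmin.
  by move: em; rewrite /T addr0 x0E ea.
exists (x0 + m%:R); split.
  case: (boolP (eigenvalue A (tau _ 0))) => // nem.
  by have := mmin m; rewrite ltnn /T; move: nem; rewrite /tau !subr0 => -> /(_ isT).
by move: em; rewrite /T -natr1; congr (~~ eigenvalue A _); ring.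
Qed.
End Closed.

(** * Isomorphisms within orbits, injectivity, and recognition of the model *)

Section Classify.
Variables (F : closedFieldType) (d : nat).
Hypothesis ch : [pchar F] =i pred0.
Let nz2 : (2%:R : F) != 0 := natr_neq0 ch 1.

Lemma Rd_comm (a b c : F) :
  comm (rA (Rd d a b c)) (rB (Rd d a b c)) = 2%:R *: rD (Rd d a b c).
Proof. by rewrite /= scalerA mulfV ?nz2 // scale1r. Qed.

Lemma racah_iso_trace (X Y : racah_mx F d.+1) : racah_iso X Y ->
  [/\ \tr (rA X) = \tr (rA Y), \tr (rB X) = \tr (rB Y) & \tr (rC X) = \tr (rC Y)].
Proof.
case=> P [uP [PA PB PC _]].
have tr M N : P *m M = N *m P -> \tr M = \tr N.
  by move=> E; rewrite -[M](mulKmx uP) E mxtrace_mulC mulmxK.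
by split; apply: tr.
Qed.

Lemma sum_thetaR (a a' : F) : \sum_(i < d.+1) thetaR d a i = \sum_(i < d.+1) thetaR d a' i ->
  a' = a \/ a' = - a - 1.
Proof.
(* Here h is independent of n, since d/2 must stay fixed during the induction; n = d + 1 and h = d/2
   turn the last factor into a + a' + 1. *)
have key n (h : F) : \sum_(i < n) ((a + h - i%:R) * (a + h - i%:R + 1) -
    (a' + h - i%:R) * (a' + h - i%:R + 1)) = n%:R * (a - a') * (a + a' + 2%:R * h + 2%:R - n%:R).
  elim: n => [|n IH]; first by rewrite big_ord0 !mul0r.
  by rewrite big_ord_recr /= IH; ring.
move/eqP; rewrite -subr_eq0 -sumrB key => /eqP E.
have : d.+1%:R * ((a - a') * (a + a' + 1)) = 0 :> F by rewrite -[RHS]E; field; exact: nz2.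
move/eqP; rewrite !mulf_eq0 (negPf (natr_neq0 ch d)) /= => /orP[]; rewrite ?subr_eq0.
  by move/eqP->; left.
by move/eqP => H; right; apply: (eq_of_sub H); ring.
Qed.

Lemma Rd_iso_orbit (a b c a' b' c' : F) :
  racah_iso (Rd d a b c) (Rd d a' b' c') -> same_orbit a b c a' b' c'.
Proof.
case/racah_iso_trace => /= trA trB.
have trRA u : \tr (Rd_A d u) = \sum_(i < d.+1) thetaR d u i :> F.
  by apply: eq_bigr => i _; rewrite mxE eqxx.
have trRB u v w : \tr (Rd_B d u v w) = \sum_(i < d.+1) thetaR d v i :> F.
  by apply: eq_bigr => i _; rewrite mxE eqxx.
rewrite !linearB /= trA trB !mxtrace_scalar => E.
have dE : delta_sc d a b c = delta_sc d a' b' c'.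
  apply: (mulfI (natr_neq0 ch d)).
  move: (delta_sc d a b c) (delta_sc d a' b' c') (\tr _) (\tr _) E => u u' v v' E.
  by apply: (eq_of_sub E); ring.
clear E.
rewrite !trRA in trA; rewrite !trRB in trB.
have aE := sum_thetaR trA; have bE := sum_thetaR trB.
have cE : c' = c \/ c' = - c - 1.
  have E : (c - c') * (c + c' + 1) = 0.
    have aa : a * (a + 1) = a' * (a' + 1) by case: aE => ->; ring.
    have bb : b * (b + 1) = b' * (b' + 1) by case: bE => ->; ring.
    move: dE; rewrite /delta_sc aa bb => /addrI dE.
    by apply: (eq_of_sub dE); ring.
  move/eqP: E; rewrite mulf_eq0 subr_eq0 => /orP[/eqP->|/eqP H]; first by left.
  by right; apply: (eq_of_sub H); ring.
have flipE (u u' : F) : u' = u \/ u' = - u - 1 -> exists s, u' = flip s u.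
  by case=> ->; [exists false | exists true].
have [s1 ?] := flipE _ _ aE; have [s2 ?] := flipE _ _ bE; have [s3 ?] := flipE _ _ cE.
by exists s1, s2, s3.
Qed.

(** Conjugation of [flip_iso] by [swap_iso]: the swapped model has parameters (-b - 1, -a - 1, c),
    and flipping the first gives (b, -a - 1, c), the swap of (a, -b - 1, c). *)
Lemma flip_iso_b (a b c : F) : inPd d a b c ->
  pair_iso (RA d a) (RB d a b c) (RA d a) (RB d a (- b - 1) c).
Proof.
move=> abc; have irr := inPd_irr ch abc; have irrb := inPd_irr ch (inPd_flip_b ch abc).
have s1 := swap_iso ch irr; have s2 := swap_iso ch irrb.
have opp : - (- b - 1) - 1 = b by ring.
rewrite opp in s2.
have f := flip_iso ch (pair_irr_iso s1 (pair_irr_swap irr)); rewrite opp in f.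
exact: pair_iso_swap (pair_iso_trans (pair_iso_trans s1 f) (pair_iso_sym s2)).
Qed.

Lemma RB_flip_c (a b c : F) : RB d a b (- c - 1) = RB d a b c.
Proof.
apply: row_ext => i; rewrite !unit_row_RB; congr (_ + _ *: _).
by rewrite /phiR; ring.
Qed.

Lemma pair_iso_refl (A B : 'M[F]_d.+1) : pair_iso A B A B.
Proof. by exists 1%:M; rewrite ?unitmx1 // !mul1mx !mulmx1. Qed.

Lemma orbit_iso (a b c a' b' c' : F) : inPd d a b c -> same_orbit a b c a' b' c' ->
  racah_iso (Rd d a b c) (Rd d a' b' c').
Proof.
move=> abc [s1 [s2 [s3 [-> -> ->]]]].
have dE : delta_sc d (flip s1 a) (flip s2 b) (flip s3 c) = delta_sc d a b c.
  by rewrite /delta_sc /flip; case: s1; case: s2; case: s3; ring.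
apply: (racah_iso_pair nz2 (Rd_comm _ _ _) (Rd_comm _ _ _) (erefl _)).
  by rewrite /= dE.
rewrite /= -/(RA d _) -/(RA d _) -/(RB d _ _ _) -/(RB d _ _ _).
have -> : RB d (flip s1 a) (flip s2 b) (flip s3 c) = RB d (flip s1 a) (flip s2 b) c.
  by case: s3 dE => // _; rewrite RB_flip_c.
apply: pair_iso_sym.
apply: (pair_iso_trans (A' := RA d (flip s1 a)) (B' := RB d (flip s1 a) b c)).
  case: s1 {dE}; last exact: pair_iso_refl.
  by have irr := inPd_irr ch abc; apply: flip_iso.
have abc' : inPd d (flip s1 a) b c by case: s1 {dE} => //; apply: inPd_flip_a.
case: s2 {dE}; last exact: pair_iso_refl.
exact: flip_iso_b.
Qed.

(** If phi_i = 0, the span of v_i, ..., v_d is stable; it contains v_d, and it is proper because i >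
    0 makes coordinate 0 vanish. *)
Lemma irr_phi (a b c : F) i : pair_irr (RA d a) (RB d a b c) -> (1 <= i <= d)%N ->
  phiR d a b c i != 0.
Proof.
move=> irr /andP[i1 id]; apply/eqP => phi0.
pose v k := unit_row F d (i + k); pose U := span_lt v (d.+1 - i).
have inU j : (i <= j)%N -> (unit_row F d j <= U)%MS.
  move=> leij; case: (ltnP j d.+1) => [ltj|lej]; last by rewrite unit_row_big // sub0mx.
  rewrite -[j](subnKC leij); apply: (span_lt_mem v); lia.
have full : row_full U.
  apply: irr.
  - apply: span_lt_stable => j ltj; rewrite unit_row_RA addmx_sub //.
      by rewrite scalemx_sub // inU // leq_addr.
    by rewrite inU // leqW // leq_addr.
  - apply: span_lt_stable => j ltj; rewrite unit_row_RB addmx_sub //.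
      by rewrite scalemx_sub // inU // leq_addr.
    case: j {ltj} => [|j]; first by rewrite addn0 phi0 scale0r sub0mx.
    by rewrite addnS scalemx_sub // inU // leq_addr.
  apply/eqP => U0; have := inU d id; rewrite U0 submx0 => /eqP/rowP/(_ ord_max).
  by rewrite !mxE eqxx => /eqP; rewrite oner_eq0.
have : (U <= kermx (delta_mx ord0 ord0 : 'cV[F]_d.+1))%MS.
  apply: span_lt_sub => j _; rewrite sub_kermx; apply/eqP/matrixP => s t.
  rewrite [RHS]mxE mxE big1 // => k _; rewrite !mxE.
  case: eqP => [kj|_]; last by rewrite mul0r.
  rewrite mul1r; case: eqP => //= k0; move: kj i1; rewrite k0 /=; lia.
rewrite sub_kermx => /eqP U0.
have := submx_full (1%:M : 'M_d.+1) full => /submxP[M ME].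
have : (1%:M : 'M[F]_d.+1) *m (delta_mx ord0 ord0 : 'cV[F]_d.+1) = 0.
  by rewrite ME -mulmxA U0 mulmx0.
rewrite mul1mx => /matrixP/(_ ord0 ord0); rewrite !mxE !eqxx => /eqP.
by rewrite oner_eq0.
Qed.

Lemma irr_inPd (a b c : F) : pair_irr (RA d a) (RB d a b c) -> inPd d a b c.
Proof.
move=> irr; apply: phi_inPd => // i ri; apply: irr_phi => //.
exact: pair_irr_iso (flip_iso ch irr) irr.
Qed.

(** The difference p - q has zero second differences and vanishes at 0, so it is i times a constant;
    its zero at d + 1 kills the constant in characteristic 0. *)
Lemma phi_unique (p q : nat -> F) : p 0%N = q 0%N -> p d.+1 = q d.+1 ->
  (forall i, (i < d)%N -> p i.+2 - 2%:R * p i.+1 + p i = q i.+2 - 2%:R * q i.+1 + q i) ->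
  forall i, (i <= d.+1)%N -> p i = q i.
Proof.
move=> p0 pd pq.
have lin i : (i <= d.+1)%N -> p i - q i = i%:R * (p 1%N - q 1%N).
  elim/ltn_ind: i => -[_ _|[_ _|i IH lei]].
  - by rewrite p0 subrr mul0r.
  - by rewrite mul1r.
  have E1 := IH i.+1 (leqnn _) (ltnW lei); have E0 := IH i (leqW (leqnn _)) (ltnW (ltnW lei)).
  have E := pq i lei; have {E0 E1} E2 := f_equal2 (fun x y => 2%:R * x - y) E1 E0.
  have {E E2} := f_equal2 +%R E E2 => E.
  by apply: (eq_of_sub E); ring.
have /eqP := lin _ (leqnn _); rewrite pd subrr eq_sym mulf_eq0 (negPf (natr_neq0 ch d)) /=.
move=> /eqP E i lei; apply/eqP; rewrite -subr_eq0 lin // E mulr0 //.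
Qed.

Lemma pair_classify (A B : 'M[F]_d.+1) dl al be :
  racah_rel A B dl al -> racah_rel B A dl be -> pair_irr A B ->
  exists a b c : F, delta_sc d a b c = dl /\ pair_iso A B (RA d a) (RB d a b c).
Proof.
move=> relA relB irr.
have [x [ex nex]] := exists_last_eigenvalue ch A (ltn0Sn d).
have [y [ey ney]] := exists_last_eigenvalue ch B (ltn0Sn d).
have [w [p [wd p0 pd [wA wB wfree]]]] := bidiagonal_string relA relB irr ex nex ey ney.
set h : F := d%:R / 2%:R; pose a := x - h; pose b := y - h.
(* The choices of a and b match the diagonals; c is then chosen to give delta the value [dl]. *)
have [c cE] := solve_quadratic (dl - h * (h + 1) - a * (a + 1) - b * (b + 1)).
have dlE : delta_sc d a b c = dl by rewrite /delta_sc cE -/h; ring.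
exists a, b, c; split=> //.
have tA i : thetaR d a i = tau x i by rewrite /thetaR /tau -/h subrK.
have tB i : thetaR d b i = tau y i by rewrite /thetaR /tau -/h subrK.
have dE : (d%:R : F) = 2%:R * h by rewrite /h mulrC divfK ?nz2.
have pE : forall i, (i <= d.+1)%N -> p i = phiR d a b c i.
  apply: phi_unique.
  - by rewrite p0 /phiR !mul0r.
  - have E : d.+1%:R - d%:R - 1 = 0 :> F by ring.
    by rewrite pd /phiR E mulr0 !mul0r.
  move=> i lti.
  have H := rel_recursion relA (fun k (_ : (k <= i.+1)%N) => wA k) (fun k _ => wB k) p0.
  set c2 := (X in _ = _ *: _ + X *: w i.+1 + _ + _) in H.
  (* Two expressions for w_(i+2) B are compared: their w_(i+2) terms agree, and w_(i+1) is
     independent of its predecessors. This includes i + 2 = d + 1, where w_(i+2) = 0. The resulting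
     equation prescribes the second difference of p. *)
  have c2E : p i.+2 = c2.
    apply/eqP; rewrite -subr_eq0; apply/negPn/negP => nz.
    have := wfree i.+1 lti; rewrite -(eqmx_scale _ nz); case/negP.
    have -> : (p i.+2 - c2) *: w i.+1 =
      (p i.+1 * (tau x i + 2%:R - tau x i.+1) - p i * (tau x i.-1 - tau x i - 2%:R)
       + 4%:R * tau x i * tau y i + 2%:R * tau x i * tau x i - 2%:R * dl * tau x i + 2%:R * al) *: w i
    + (p i * (2%:R * (tau x i + tau x i.-1) - (tau x i - tau x i.-1) ^+ 2)) *: w i.-1.
      have {H} := etrans (esym (wB i.+2)) H.
      rewrite /= => H; apply/rowP => j; have {H} := congr1 (fun u : 'rV_d.+1 => u 0 j) H.
      move: (c2) (p i.+2) (p i.+1) (p i) => c2' p2 p1 pi; rewrite !mxE /tau => H.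
      by apply: (eq_of_sub H); ring.
    rewrite addmx_sub ?scalemx_sub ?span_lt_mem //.
    by case: (i) => //= k; apply: leqW; apply: leqW.
  rewrite c2E /c2 -dlE /delta_sc /phiR /tau -/h dE.
  have -> : x = a + h by rewrite subrK.
  have -> : y = b + h by rewrite subrK.
  ring.
apply: (string_iso irr (w := w)) => //.
- apply: contra (wfree 0%N (leq0n d)) => /eqP->; exact: sub0mx.
- by move=> i _; rewrite tA.
by move=> i lei; rewrite tB wB pE // leqW.
Qed.

End Classify.

(** * Centrality of delta *)

Section Generators.
Variables (F : fieldType) (n : nat).
Hypothesis nz2 : (2%:R : F) != 0.

(** In each commutator of delta with A, B or C two terms survive, 2D and -2D; D is half a commutator
    of A and B. *)
Lemma r_delta_central (X : racah_mx F n) : is_racah_module X -> commutes_all X (r_delta X).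
Proof.
case=> [[AB BC CA] _].
have eq_comm (M N : 'M[F]_n) : comm M N = 0 -> M *m N = N *m M.
  by move/eqP; rewrite subr_eq0 => /eqP.
have dA : r_delta X *m rA X = rA X *m r_delta X.
  apply: eq_comm; rewrite -[RHS](subrr (2%:R *: rD X)) -{1}CA -AB /comm /r_delta.
  rewrite !(mulmxDl, mulmxDr).
  move: (rA X *m rA X) (rA X *m rB X) (rB X *m rA X) (rA X *m rC X) (rC X *m rA X) => *.
  by apply/matrixP => i j; rewrite !mxE; ring.
have dB : r_delta X *m rB X = rB X *m r_delta X.
  apply: eq_comm; rewrite -[RHS](subrr (2%:R *: rD X)) -{1}AB -BC /comm /r_delta.
  rewrite !(mulmxDl, mulmxDr).
  move: (rB X *m rB X) (rA X *m rB X) (rB X *m rA X) (rB X *m rC X) (rC X *m rB X) => *.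
  by apply/matrixP => i j; rewrite !mxE; ring.
split=> //.
  apply: eq_comm; rewrite -[RHS](subrr (2%:R *: rD X)) -{1}BC -CA /comm /r_delta.
  rewrite !(mulmxDl, mulmxDr).
  move: (rC X *m rC X) (rC X *m rB X) (rB X *m rC X) (rA X *m rC X) (rC X *m rA X) => *.
  by apply/matrixP => i j; rewrite !mxE; ring.
rewrite (eq_half_comm nz2 AB) -scalemxAr -scalemxAl mulmxBr mulmxBl; congr (_ *: (_ - _)).
  by rewrite mulmxA dA -mulmxA dB mulmxA.
by rewrite mulmxA dB -mulmxA dA mulmxA.
Qed.

End Generators.

Theorem theorem2p5 (F : closedFieldType) (charF0 : [pchar F] =i pred0) (d : nat) :
  (* R_d(a,b,c) (for (a,b,c) in P_d) is an irreducible R-module of dim d+1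
     on which alpha, beta, delta act as the prescribed scalars *)
  (forall a b c : F, inPd d a b c ->
     [/\ is_racah_module (Rd d a b c),
         r_alpha (Rd d a b c) = (alpha_sc d a b c)%:M,
         r_beta (Rd d a b c) = (beta_sc d a b c)%:M,
         r_delta (Rd d a b c) = (delta_sc d a b c)%:M &
         racah_irreducible (Rd d a b c)]) /\
  (* well defined on orbits *)
  (forall a b c a' b' c' : F, inPd d a b c -> inPd d a' b' c' ->
     same_orbit a b c a' b' c' -> racah_iso (Rd d a b c) (Rd d a' b' c')) /\
  (* injective *)
  (forall a b c a' b' c' : F, inPd d a b c -> inPd d a' b' c' ->
     racah_iso (Rd d a b c) (Rd d a' b' c') -> same_orbit a b c a' b' c') /\
  (* surjective *)
  (forall X : racah_mx F d.+1, is_racah_module X -> racah_irreducible X ->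
     exists a b c : F, inPd d a b c /\ racah_iso X (Rd d a b c)).
Proof.
have nz2 : (2%:R : F) != 0 := natr_neq0 charF0 1.
have RdC (a b c : F) : rC (Rd d a b c) = (delta_sc d a b c)%:M - rA (Rd d a b c) - rB (Rd d a b c).
  by [].
split; last split; last split.
- move=> a b c abc.
  have alE : r_alpha (Rd d a b c) = (alpha_sc d a b c)%:M.
    apply: (r_alphaP nz2 _ (Rd_comm d charF0 a b c) (RdC a b c)).2.
    by have := racah_rel_tr (Rd_rel_alpha d nz2 a b c); rewrite !trmxK.
  have beE : r_beta (Rd d a b c) = (beta_sc d a b c)%:M.
    apply: (r_betaP nz2 _ (Rd_comm d charF0 a b c) (RdC a b c)).2.
    by have := racah_rel_tr (Rd_rel_beta d nz2 a b c); rewrite !trmxK.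
  split=> //.
  + exact: racah_module_of_rel (Rd_comm d charF0 a b c) (RdC a b c) alE beE.
  + by rewrite /r_delta RdC -[X in _ + X]addrA -opprD [LHS]addrC subrK.
  by apply: irr_of_pair => //; apply: inPd_irr.
- by move=> a b c a' b' c' abc _; apply: orbit_iso.
- by move=> a b c a' b' c' _ _; apply: Rd_iso_orbit.
move=> X modX irrX.
(* Schur's lemma turns delta, and then alpha and beta, into scalars, which reduces the module to a
   pair satisfying both relations. *)
have [dl dE] := racah_schur irrX (r_delta_central nz2 modX).
case: (modX) => [[AB _ _] [alC beC _]].
have [al alE] := racah_schur irrX alC; have [be beE] := racah_schur irrX beC.
have CE : rC X = dl%:M - rA X - rB X by rewrite -dE /r_delta -addrA -opprD addrC addKr.
have irr := pair_of_irr nz2 AB CE irrX.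
have relA := racah_rel_tr ((r_alphaP nz2 al AB CE).1 alE).
have relB := racah_rel_tr ((r_betaP nz2 be AB CE).1 beE).
have [a [b [c [dlE iso]]]] := pair_classify charF0 relA relB irr.
exists a, b, c; split.
  (* Membership in P_d comes from the irreducibility of X, carried over to the model. *)
  by apply: (irr_inPd charF0); apply: pair_irr_iso iso irr.
apply: (racah_iso_pair nz2 (dl := dl) AB (Rd_comm d charF0 a b c) CE); first by rewrite RdC dlE.
exact: pair_iso_sym.
Qed.
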